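(* Let $H$ be an infinite dimensional complex Hilbert space, let $T \in \mathcal{B}(H)$ be norm attaining and $\ast$-paranormal, and let $M = \{x \in H : \|Tx\| = \|T\|\,\|x\|\}$, which is the closed subspace $N(|T| - \|T\| I)$. Then $M$ is invariant under $T$, i.e. $T(M)\subseteq M$. Moreover, if $M$ is finite dimensional, then $M$ reduces $T$.
   Context: $\mathcal{B}(H)$ denotes the bounded linear operators on $H$, $N(\cdot)$ denotes the null space, and $|T| = (T^*T)^{1/2}$. An operator $T \in \mathcal{B}(H)$ is norm attaining if there is a unit vector $x \in H$ with $\|Tx\| = \|T\|$. $T$ is $\ast$-paranormal if $\|T^*x\|^2 \leq \|T^2x\|\,\|x\|$ for all $x \in H$. A closed subspace $M$ reduces $T$ if both $M$ and $M^\perp$ are invariant under $T$. *)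

(* Defs.v *)
From HB Require Import structures.
From mathcomp Require Import all_boot all_order all_algebra.
From mathcomp Require Import all_classical all_reals all_analysis.
From mathcomp Require Import complex.

Set Implicit Arguments.
Unset Strict Implicit.
Unset Printing Implicit Defensive.

Import Order.TTheory GRing.Theory Num.Theory.
Import numFieldNormedType.Exports.

Local Open Scope classical_set_scope.
Local Open Scope ring_scope.
Local Open Scope complex_scope.

(* The inner product is linear in its first argument and conjugate-linear in
   the second, as forced by {dot _ for _}; the norm is valued in R[i]. *)
HB.mixin Record NormedModule_isHilbert (R : realType) (H : Type)
    of CompleteNormedModule R[i] H := {
  inner : {dot H for @Num.conj R[i]};
  sqr_norm_inner : forall x : H, `|x| ^+ 2 = inner x x
}.

#[short(type="hilbertType")]
HB.structure Definition Hilbert (R : realType) :=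
  { H of CompleteNormedModule R[i] H & NormedModule_isHilbert R H }.

Section Subspaces.
Variables (R : realType) (H : hilbertType R).
Implicit Types (M : set H) (s : seq H).

Definition is_subspace M : Prop :=
  M 0 /\ forall (a : R[i]) (x y : H), M x -> M y -> M (a *: x + y).

Definition lin_span s : set H :=
  [set x | exists c : nat -> R[i], x = \sum_(i < size s) c i *: s`_i].

Definition finite_dimensional M : Prop := exists s, M = lin_span s.

Definition infinite_dimensional M : Prop := ~ finite_dimensional M.

Definition orth_compl M : set H :=
  [set y | forall x, M x -> inner x y = 0].

End Subspaces.

Section Operators.
Variables (R : realType) (H : hilbertType R).
Implicit Types (T A S : H -> H) (M : set H).

Definition bounded_operator T : Prop :=
  linear T /\ exists C : R[i], forall x, `|T x| <= C * `|x|.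

(* The supremum is taken in R, where suprema exist, and sent back to R[i],
   where the norm of H lives. *)
Definition opnorm T : R[i] :=
  (sup [set complex.Re `|T x| | x in [set x : H | `|x| <= 1]])%:C.

(* For bounded T, the vector chosen exists by the Riesz representation theorem
   and is unique. *)
Definition adjoint T : H -> H :=
  fun y => xget 0 [set z | forall x, inner (T x) y = inner x z].

(* The order of R[i] makes 0 <= z mean that z is real and nonnegative. *)
Definition positive_operator A : Prop :=
  bounded_operator A /\ forall x, 0 <= inner (A x) x.

(* For positive S, the operator chosen exists and is unique. *)
Definition sqrt_operator S : H -> H :=
  xget (fun=> 0) [set A | positive_operator A /\ forall x, A (A x) = S x].

Definition abs_operator T : H -> H := sqrt_operator (adjoint T \o T).

Definition null_space A : set H := [set x | A x = 0].

Definition norm_attaining T : Prop :=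
  exists x : H, `|x| = 1 /\ `|T x| = opnorm T.

Definition star_paranormal T : Prop :=
  forall x : H, `|adjoint T x| ^+ 2 <= `|T (T x)| * `|x|.

Definition norming_set T : set H := [set x | `|T x| = opnorm T * `|x|].

Definition invariant_subspace M T : Prop := T @` M `<=` M.

Definition reduces M T : Prop :=
  invariant_subspace M T /\ invariant_subspace (orth_compl M) T.

End Operators.

(* Main.v *)
(* Put c = ||T||.  The identity ||Tx|| = c ||x|| amounts to T*T x = c^2 x, so
   M is an eigenspace.  For x in M, *-paranormality at Tx gives
   c^4 ||x||^2 = ||T* T x||^2 <= ||T^3 x|| ||Tx|| <= c ||T^2 x|| c ||x||, whence
   ||T^2 x|| = c ||Tx||, that is, Tx is in M.  If c <> 0 and M is finite
   dimensional, T is injective on M, hence maps M onto M; so for y orthogonal to M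
   and x = T w with w in M, <x, Ty> = <T*T w, y> = c^2 <w, y> = 0. *)
Require Import Defs.
From HB Require Import structures.
From mathcomp Require Import all_boot all_order all_algebra.
From mathcomp Require Import all_classical all_reals all_analysis.
From mathcomp Require Import complex.
From mathcomp Require Import ring lra.

Set Implicit Arguments.
Unset Strict Implicit.
Unset Printing Implicit Defensive.

Import Order.TTheory GRing.Theory Num.Theory.
Import numFieldNormedType.Exports.

Local Open Scope classical_set_scope.
Local Open Scope ring_scope.
Local Open Scope complex_scope.

(** * Real-valued norm and inner product *)

Section RealStructure.
Variables (R : realType) (H : hilbertType R).
Implicit Types (x y z : H) (a : R).

(** Norms and inner products take values in [R[i]]; their real parts lie in an ordered field, where
    [lra] and [nra] apply. *)
Definition rnorm x : R := complex.Re `|x|.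
Definition rinner x y : R := complex.Re (inner x y).

Lemma normE x : `|x| = (rnorm x)%:C.
Proof. by rewrite /rnorm RRe_real // ger0_real. Qed.

Lemma rnorm_ge0 x : 0 <= rnorm x.
Proof. by rewrite -ler0c -normE. Qed.

Lemma rnorm_eq0 x : (rnorm x == 0) = (x == 0).
Proof. by rewrite -(normr_eq0 x) normE -(inj_eq (@complexI R)). Qed.

Lemma rnorm0 : rnorm 0 = 0.
Proof. by apply/eqP; rewrite rnorm_eq0. Qed.

Lemma rnorm_le0 x : rnorm x <= 0 -> x = 0.
Proof.
by move=> h; apply/eqP; rewrite -rnorm_eq0 eq_le h rnorm_ge0.
Qed.

Lemma rnormN x : rnorm (- x) = rnorm x.
Proof. by rewrite /rnorm normrN. Qed.

Lemma rnormB x y : rnorm (x - y) = rnorm (y - x).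
Proof. by rewrite /rnorm distrC. Qed.

Lemma ler_rnormD x y : rnorm (x + y) <= rnorm x + rnorm y.
Proof. by rewrite -lecR rmorphD /= -!normE ler_normD. Qed.

Lemma ler_rnorm_dist x y z : rnorm (x - z) <= rnorm (x - y) + rnorm (y - z).
Proof. by rewrite -[x - z](subrKA y) ler_rnormD. Qed.

Lemma rnormZ a x : rnorm (a%:C *: x) = `|a| * rnorm x.
Proof.
apply: (@complexI R); rewrite rmorphM /= -!normE normrZ; congr (_ * _).
by rewrite normc_def /= expr0n addr0 sqrtr_sqr.
Qed.

Lemma innerC x y : inner x y = (inner y x)^*.
Proof. by rewrite hermC /= expr0 mul1r. Qed.

Lemma rinnerC x y : rinner x y = rinner y x.
Proof. by rewrite /rinner innerC; case: (inner y x). Qed.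

Lemma rinnerDl x y z : rinner (x + y) z = rinner x z + rinner y z.
Proof. by rewrite /rinner linearDl (raddfD (@complex.Re R)). Qed.

Lemma rinnerZl a x y : rinner (a%:C *: x) y = a * rinner x y.
Proof.
by rewrite /rinner linearZl_LR /=; case: (inner x y) => b c /=; rewrite mul0r subr0.
Qed.

Lemma rinnerNl x y : rinner (- x) y = - rinner x y.
Proof. by rewrite -scaleN1r -[-1](rmorphN1 (real_complex R)) rinnerZl mulN1r. Qed.

Lemma rinnerBl x y z : rinner (x - y) z = rinner x z - rinner y z.
Proof. by rewrite rinnerDl rinnerNl. Qed.

Lemma rinnerDr x y z : rinner x (y + z) = rinner x y + rinner x z.
Proof. by rewrite rinnerC rinnerDl !(rinnerC _ x). Qed.

Lemma rinnerZr a x y : rinner x (a%:C *: y) = a * rinner x y.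
Proof. by rewrite rinnerC rinnerZl rinnerC. Qed.

Lemma rinnerNr x y : rinner x (- y) = - rinner x y.
Proof. by rewrite rinnerC rinnerNl rinnerC. Qed.

Lemma rinnerBr x y z : rinner x (y - z) = rinner x y - rinner x z.
Proof. by rewrite rinnerDr rinnerNr. Qed.

Lemma rinnerii x : rinner x x = rnorm x ^+ 2.
Proof. by rewrite /rinner -sqr_norm_inner normE -rmorphXn. Qed.

(** Cauchy-Schwarz: with a = |x|, b = |y| and p = [rinner x y], expanding the squared norm of b x -
    a y gives 2ab(ab - p) >= 0. Zero vectors are treated apart so that ab can be cancelled. *)
Lemma rinner_le x y : rinner x y <= rnorm x * rnorm y.
Proof.
have [->|y0] := eqVneq y 0.
  by rewrite -[X in rinner x X](subrr x) rinnerBr subrr rnorm0 mulr0.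
have [->|x0] := eqVneq x 0.
  by rewrite -[X in rinner X y](subrr y) rinnerBl subrr rnorm0 mul0r.
have nx : 0 < rnorm x by rewrite lt_neqAle eq_sym rnorm_eq0 x0 rnorm_ge0.
have ny : 0 < rnorm y by rewrite lt_neqAle eq_sym rnorm_eq0 y0 rnorm_ge0.
have := sqr_ge0 (rnorm ((rnorm y)%:C *: x - (rnorm x)%:C *: y)).
rewrite -rinnerii !(rinnerBl, rinnerBr, rinnerZl, rinnerZr) !rinnerii (rinnerC y x).
set p := rinner x y; set a := rnorm x; set b := rnorm y => h.
have : 0 <= (a * b) * (a * b - p) by nra.
by rewrite pmulr_rge0 ?mulr_gt0 // subr_ge0.
Qed.

Lemma normr_rinner_le x y : `|rinner x y| <= rnorm x * rnorm y.
Proof. by rewrite ler_norml rinner_le lerNl -rinnerNl -(rnormN x) rinner_le. Qed.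

(** Conjugate-linearity on the right turns <x, iy> into -i <x, y>, whose real part is the imaginary
    part of <x, y>. *)
Lemma inner_rinner x y : inner x y = rinner x y +i* rinner x ('i *: y).
Proof.
rewrite /rinner linearZr_LR /=; case: (inner x y) => b c /=.
by congr (_ +i* _); lra.
Qed.

End RealStructure.

(** * Limits with the explicit rate K / (n + 1) *)

Section Completeness.
Variables (R : realType) (H : hilbertType R).
Implicit Types (x y z : H) (K : R).

(** The Archimedean property, in the form that later replaces passages to the limit: a fixed defect
    is bounded by a multiple of 1 / (n + 1) for every n. *)
Lemma ler_harmonic_le0 K a : (forall n, a <= K / n.+1%:R) -> a <= 0.
Proof.
move=> h; rewrite leNgt; apply/negP => a0.
have K0 : 0 < K by have := h 0%N; rewrite divr1; exact: lt_le_trans.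
have := h (Num.truncn (K / a)); apply/negP; rewrite -ltNge.
rewrite ltr_pdivrMr ?ltr0n // mulrC -ltr_pdivrMr //.
exact: truncnS_gt.
Qed.

(** Completeness; letting m tend to infinity in the hypothesis preserves the rate. *)
Lemma harmonic_cvg (u : nat -> H) K :
  (forall n m, (n <= m)%N -> rnorm (u m - u n) <= K / n.+1%:R) ->
  exists l, forall n, rnorm (u n - l) <= K / n.+1%:R.
Proof.
move=> hu.
have small (e : R) : 0 < e -> exists N, K / N.+1%:R < e.
  move=> e0; exists (Num.truncn (K / e)).
  by rewrite ltr_pdivrMr ?ltr0n // mulrC -ltr_pdivrMr // truncnS_gt.
have cu : cvg (u @ \oo).
  apply: cauchy_cvg; apply: cauchy_exP => _/posnumP[e].
  have [r er] : exists r, e%:num = r%:C :> R[i].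
    by exists (complex.Re e%:num); rewrite RRe_real.
  have [|N hN] := small r; first by rewrite -ltcR -er; exact: gt0.
  exists (u N); exists N => //= n /= Nn.
  rewrite -ball_normE /= normE er ltcR rnormB.
  exact: le_lt_trans (hu _ _ Nn) hN.
(* The bound holds up to 1 / (k + 1) for every k, by comparison with a term whose index exceeds both
   [N] and [n]. *)
exists (lim (u @ \oo)) => n; rewrite -subr_le0; apply: (@ler_harmonic_le0 1) => k.
have k0 : 0 < (1 / k.+1%:R : R) by rewrite divr_gt0.
have k0C : 0 < (1 / k.+1%:R : R)%:C by rewrite ltcR.
move/cvgrPdist_lt: cu => /(_ _ k0C)[N _ hN].
have /= := hN (maxn N n) (leq_maxl _ _); rewrite normE ltcR => h1.
have h2 := hu _ _ (leq_maxr N n).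
have := ler_rnorm_dist (u n) (u (maxn N n)) (lim (u @ \oo)).
rewrite (rnormB (u n) (u _)) (rnormB (u (maxn _ _)) (lim _)) => h3.
by rewrite lerBlDr (le_trans h3) // addrC lerD // ltW.
Qed.

End Completeness.

(** * Riesz representation of bounded real-linear functionals *)

(* The representing vector is the minimizer of J: the parallelogram identity makes
   a minimizing sequence Cauchy. *)
Section Riesz.
Variables (R : realType) (H : hilbertType R) (f : H -> R) (C : R).
Hypothesis fD : forall x y, f (x + y) = f x + f y.
Hypothesis fZ : forall a x, f (a%:C *: x) = a * f x.
Hypothesis fC : forall x, f x <= C * rnorm x.

Let J (z : H) := rnorm z ^+ 2 - 2 * f z.

Let J_ge z : - C ^+ 2 <= J z.
Proof. by have := fC z; have := sqr_ge0 (rnorm z - C); rewrite /J; nra. Qed.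

Let fB x y : f (x - y) = f x - f y.
Proof.
by rewrite -[- y]scaleN1r -[-1](rmorphN1 (real_complex R)) fD fZ mulN1r.
Qed.

Let J_midpoint u v :
  J u + J v = 2 * J ((1 / 2)%:C *: (u + v)) + 1 / 2 * rnorm (u - v) ^+ 2.
Proof.
rewrite /J -!rinnerii fZ fD.
rewrite !(rinnerZl, rinnerZr, rinnerBl, rinnerBr, rinnerDl, rinnerDr) (rinnerC v u).
by field.
Qed.

Lemma riesz_real : exists z, forall x, f x = rinner x z.
Proof.
have hinf : has_inf (range J).
  by split; [exists (J 0), 0 | exists (- C ^+ 2) => _ [z _ <-]].
set m := inf (range J).
have m_le z : m <= J z by apply: ge_inf; [exact: hinf.2 | exists z].
(* With e = 1 / (n + 1), the tolerance (e / 2)^2 makes the midpoint identity give |u k - u n|^2 / 2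
   <= 2 (e / 2)^2 for k >= n, that is, a distance of at most e. *)
have [u hu] : exists u : nat -> H,
    forall n, J (u n) <= m + (1 / 2 / n.+1%:R) ^+ 2.
  suff : forall n, exists z, J z <= m + (1 / 2 / n.+1%:R) ^+ 2.
    by move/choice=> [v hv]; exists v.
  move=> n.
  have e0 : 0 < (1 / 2 / n.+1%:R) ^+ 2 :> R by rewrite exprn_gt0 // !divr_gt0.
  by have [_ [z _ <-] /ltW hz] := inf_adherent e0 hinf; exists z.
have [|z hz] := @harmonic_cvg R H u 1.
  move=> n k nk; have := J_midpoint (u k) (u n).
  have := m_le ((1 / 2)%:C *: (u k + u n)).
  have := hu n; have := hu k.
  have : (1 / 2 / k.+1%:R) ^+ 2 <= (1 / 2 / n.+1%:R) ^+ 2 :> R.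
    rewrite ler_sqr ?nnegrE ?divr_ge0 // ler_wpM2l ?divr_ge0 //.
    by rewrite lef_pV2 ?posrE ?ltr0n // ler_nat.
  have -> : 1 / 2 / n.+1%:R = 1 / 2 * (1 / n.+1%:R) :> R by rewrite mulrA mulr1.
  have : 0 <= 1 / n.+1%:R :> R by rewrite divr_ge0.
  have := rnorm_ge0 (u k - u n).
  set e := 1 / _; set d := rnorm _ => d0 e0 h1 h2 h3 h4 h5.
  suff : d ^+ 2 <= e ^+ 2 by rewrite ler_sqr ?nnegrE.
  clear -h1 h2 h3 h4 h5; move: h1 h2 h3 h4 h5.
  set ek := _ / k.+1%:R. clearbody m J e d ek.
  by move=> *; lra.
(* Continuity of [J] made explicit: with e = 1 / (n + 1), passing from [u n] to [z] raises the
   squared norm by at most 2 |z| e and changes [f] by at most |C| e; [L] generously covers these and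
   the tolerance. *)
have Jz : J z <= m.
  rewrite -subr_le0; pose L := 1 + (2 * rnorm z + 1) + 2 * `|C|.
  apply: (@ler_harmonic_le0 R L) => n.
  have := hu n; have := hz n.
  have : 1 / n.+1%:R <= 1 :> R.
    by rewrite ler_pdivrMr ?ltr0n // mul1r ler1n.
  have : 0 <= 1 / n.+1%:R :> R by rewrite divr_ge0.
  have -> : 1 / 2 / n.+1%:R = 1 / 2 * (1 / n.+1%:R) :> R by rewrite mulrA mulr1.
  have -> : L / n.+1%:R = L * (1 / n.+1%:R) by rewrite mul1r.
  have := ler_rnormD (u n) (z - u n); rewrite subrKC (rnormB z).
  have := fC (u n - z); rewrite fB.
  have : C * rnorm (u n - z) <= `|C| * rnorm (u n - z).
    by rewrite ler_wpM2r ?rnorm_ge0 ?ler_norm.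
  have := normr_ge0 C; have := rnorm_ge0 (u n); have := rnorm_ge0 z.
  have := rnorm_ge0 (u n - z).
  rewrite /J /L; set e := 1 / _; set d := rnorm (u n - z).
  set a := rnorm (u n); set b := rnorm z; set c := `|C|.
  move: (f (u n)) (f z) m {hu hz m_le hinf}.
  clearbody e d a b c; clear => fu fz m.
  move=> d0 b0 a0 c0 h1 h2 h3 e0 e1 de h4.
  have : b ^+ 2 <= a ^+ 2 + 2 * b * d.
    by have [bd|bd] := lerP b d; nra.
  have : c * d <= c * e by rewrite ler_wpM2l.
  have : b * d <= b * e by rewrite ler_wpM2l.
  have : e ^+ 2 <= e by rewrite expr2 ler_piMr.
  nra.
exists z => x.
(* Minimality of [z] along the line z + t x. *)
have quad t : 0 <= t ^+ 2 * rnorm x ^+ 2 + 2 * t * (rinner x z - f x).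
  have := le_trans Jz (m_le (z + t%:C *: x)); rewrite /J fD fZ -!rinnerii.
  rewrite !(rinnerZl, rinnerZr, rinnerDl, rinnerDr) (rinnerC z x); nra.
(* The quadratic q t^2 + 2 p t is minimal at -p / q; the denominator q + 1 avoids a separate case q
   = 0 and still gives a negative value unless p = 0. *)
have := quad (- (rinner x z - f x) / (rnorm x ^+ 2 + 1)).
set p := rinner x z - f x; set q := rnorm x ^+ 2.
have q0 : 0 <= q by rewrite exprn_ge0 ?rnorm_ge0.
have -> : (- p / (q + 1)) ^+ 2 * q + 2 * (- p / (q + 1)) * p =
    - (p ^+ 2 * ((q + 2) / (q + 1) ^+ 2)).
  by field; rewrite gt_eqF //; lra.
rewrite oppr_ge0 pmulr_lle0; last by rewrite divr_gt0 ?exprn_gt0 //; lra.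
move=> hp; have /eqP : p ^+ 2 = 0 by apply: le_anti; rewrite hp sqr_ge0.
by rewrite sqrf_eq0 subr_eq0 => /eqP.
Qed.

End Riesz.

(** * Adjoints and the operator norm *)

Section Operators.
Variables (R : realType) (H : hilbertType R).
Implicit Types (x y z : H) (A T : H -> H).

(** Gives access to the library of bundled linear maps, since operators here are bare functions. *)
Lemma linear_bundle A : linear A -> exists f : {linear H -> H}, A = f.
Proof.
move=> lA.
pose m := GRing.isLinear.Build _ _ _ _ A lA.
pose f : {linear H -> H} := HB.pack A m.
by exists f.
Qed.

Lemma bounded_operator_rnorm T : bounded_operator T ->
  exists2 C : R, 0 <= C & forall x, rnorm (T x) <= C * rnorm x.
Proof.
case=> _ [C hC]; exists `|complex.Re C| => // x.
apply: (@le_trans _ _ (complex.Re C * rnorm x)).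
  have := hC x; rewrite !normE lecE => /andP[_] /=.
  by case: C {hC} => a b /=; rewrite mulr0 subr0.
by rewrite ler_wpM2r ?rnorm_ge0 ?ler_norm.
Qed.

(** The hypothesis at ['i *: x] supplies the imaginary parts, because [A] commutes with
    multiplication by i. *)
Lemma rinner_inner A x y z : linear A ->
  (forall x, rinner (A x) y = rinner x z) -> inner (A x) y = inner x z.
Proof.
move=> /linear_bundle[f ->] h.
rewrite [LHS]innerC [RHS]innerC !inner_rinner -linearZ !(rinnerC _ (f _)) !h.
by rewrite !(rinnerC z).
Qed.

(** Riesz applied to the real part of <Tx, y>, bounded by C |y| |x|, yields a vector for [xget] to
    choose. *)
Lemma adjointP T x y : bounded_operator T -> inner (T x) y = inner x (adjoint T y).
Proof.
move=> bT.
suff : exists z, forall x, inner (T x) y = inner x z.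
  by move=> /(xgetPex 0) /(_ x).
have [C C0 hC] := bounded_operator_rnorm bT.
case: bT => lT _; have [f fE] := linear_bundle lT.
have [|||z hz] := @riesz_real R H (fun x => rinner (T x) y) (C * rnorm y).
- by move=> u v; rewrite fE linearD rinnerDl.
- by move=> a u; rewrite fE linearZ rinnerZl.
- move=> u; apply: le_trans (rinner_le _ _) _.
  by rewrite mulrAC ler_wpM2r ?rnorm_ge0.
by exists z => u; apply: rinner_inner.
Qed.

Lemma rinner_adjoint T x y : bounded_operator T ->
  rinner (T x) y = rinner x (adjoint T y).
Proof. by move=> bT; rewrite /rinner adjointP. Qed.

Lemma rinner_inj y z : (forall x, rinner x y = rinner x z) -> y = z.
Proof.
move=> h; apply/eqP; rewrite -subr_eq0 -rnorm_eq0 -sqrf_eq0 -rinnerii.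
by rewrite rinnerBr h subrr.
Qed.

Lemma adjoint_linear T : bounded_operator T -> linear (adjoint T).
Proof.
move=> bT a u v; apply: rinner_inj => x; rewrite /rinner -adjointP //.
by rewrite linearPr linearPr /= !adjointP.
Qed.

(** With y = T* x, one has |y|^2 = Re <Ty, x> <= c |y| |x|, and |y| cancels. *)
Lemma rnorm_adjoint T (c : R) x : bounded_operator T ->
  (forall y, rnorm (T y) <= c * rnorm y) -> rnorm (adjoint T x) <= c * rnorm x.
Proof.
move=> bT hc; set y := adjoint T x.
have := rinner_le (T y) x; rewrite rinner_adjoint // -/y rinnerii => h.
have := hc y; have := rnorm_ge0 x; have := rnorm_ge0 y.
have : c * rnorm y * rnorm x = c * rnorm x * rnorm y by rewrite mulrAC.
(* No sign of [c] is assumed; the bound on |Tx| itself shows c |x| >= 0. *)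
have [->|y0] := eqVneq (rnorm y) 0.
  by move=> *; apply: le_trans (hc x); exact: rnorm_ge0.
move=> e y1 x0 hy; have y2 : 0 < rnorm y by rewrite lt_neqAle eq_sym y0.
rewrite -(ler_pM2r y2) -expr2 -e; apply: le_trans h _.
by rewrite ler_wpM2r.
Qed.

(** Replaces the supremum by a real [c] for later use; the bound comes from rescaling [x] to norm
    1. *)
Lemma opnormE T : exists2 c : R, opnorm T = c%:C &
  bounded_operator T -> 0 <= c /\ forall x, rnorm (T x) <= c * rnorm x.
Proof.
exists (sup [set complex.Re `|T x| | x in [set x : H | `|x| <= 1]]) => // bT.
have [C C0 hC] := bounded_operator_rnorm bT.
case: bT => lT _; have [f fE] := linear_bundle lT.
set E := [set _ | _ in _].
have E0 : E 0 by exists 0; rewrite /= ?normr0 ?ler01 // fE linear0 normr0.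
have hE : has_sup E.
  split; [by exists 0 | exists C => _ [x /= x1 <-]].
  apply: le_trans (hC x) _; rewrite -[leRHS]mulr1 ler_wpM2l //.
  by rewrite -lecR -normE.
split=> [|x]; first exact: ub_le_sup hE.2 _ E0.
have [->|x0] := eqVneq x 0; first by rewrite fE linear0 !rnorm0 mulr0.
have nx : 0 < rnorm x by rewrite lt_neqAle eq_sym rnorm_eq0 x0 rnorm_ge0.
rewrite -ler_pdivrMr //.
apply: (ub_le_sup hE.2); exists ((rnorm x)^-1%:C *: x) => /=.
  by rewrite normE (lecR _ 1) rnormZ gtr0_norm ?invr_gt0 // mulVf ?gt_eqF.
by rewrite fE linearZ -/(rnorm _) rnormZ gtr0_norm ?invr_gt0 // mulrC.
Qed.

End Operators.

(** * Existence of the positive square root of T* T *)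

Section SquareRoot.
Variables (R : realType) (H : hilbertType R).
Implicit Types (x y z : H).

Section Iteration.
Variable B : H -> H.
Hypothesis Blin : linear B.
Hypothesis Bsym : forall x y, rinner (B x) y = rinner x (B y).
Hypothesis B1 : forall x, rnorm (B x) <= rnorm x.

(* The limit Z solves Z = (B + Z^2) / 2, that is, (1 - Z)^2 = 1 - B.  The same
   recursion at the scalar B = 1 dominates the increments in norm, and its distance
   to its limit 1 is at most 2 / (n + 1). *)
Fixpoint sqrt_iter n : H -> H :=
  if n is m.+1
  then fun x => (1 / 2)%:C *: (B x + sqrt_iter m (sqrt_iter m x))
  else fun=> 0.

Fixpoint sqrt_maj n : R :=
  if n is m.+1 then 1 / 2 * (1 + sqrt_maj m ^+ 2) else 0.

Let Y := sqrt_iter.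
Let t := sqrt_maj.

Let YS n x : Y n.+1 x = (1 / 2)%:C *: (B x + Y n (Y n x)).
Proof. by []. Qed.

Let tS n : t n.+1 = 1 / 2 * (1 + t n ^+ 2).
Proof. by []. Qed.

Lemma sqrt_maj_ge0 n : 0 <= t n.
Proof. by elim: n => //= n IH; rewrite mulr_ge0 ?addr_ge0 ?exprn_ge0. Qed.

(** The gap e = 1 - t n evolves by e - e^2 / 2, which decays like 2 / n. *)
Lemma sqrt_maj_bound n : 0 <= 1 - t n <= 2 / n.+1%:R.
Proof.
(* The induction needs the sharper 2 / (n + 2), an equality at n = 0. *)
suff /andP[h1 h2] : 0 <= 1 - t n <= 2 / n.+2%:R.
  rewrite h1 (le_trans h2) // ler_wpM2l // lef_pV2 ?posrE ?ltr0n //.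
  by rewrite ler_nat.
elim: n => [|n /andP[IH1 IH2]].
  by rewrite /t /= subr0 ler01 divff ?lexx ?pnatr_eq0.
have n0 : 0 <= n%:R :> R by [].
rewrite tS; move: (t n) (sqrt_maj_ge0 n) IH1 IH2 => u u0 IH1.
rewrite -[n.+3]addn3 -[n.+2]addn2 !natrD; move: n%:R n0 => k k0 IH2.
apply/andP; split; first by nra.
have -> : 1 - 1 / 2 * (1 + u ^+ 2) = (1 - u) - (1 - u) ^+ 2 / 2 by field.
move: (1 - u) IH1 IH2 => e IH1 IH2.
set q := 2 / (k + 2) in IH2.
have q1 : q <= 1 by rewrite ler_pdivrMr; lra.
(* The map e - e^2 / 2 increases on [0, 1], so the gap may be replaced by its bound [q]. *)
apply: (@le_trans _ _ (q - q ^+ 2 / 2)); first by nra.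
rewrite -subr_ge0 /q.
have -> : 2 / (k + 3) - (2 / (k + 2) - (2 / (k + 2)) ^+ 2 / 2) =
    2 / ((k + 3) * (k + 2) ^+ 2).
  by field; rewrite !gt_eqF //; lra.
by rewrite divr_ge0 // mulr_ge0 ?exprn_ge0 //; lra.
Qed.

Lemma sqrt_iter_linear n : linear (Y n).
Proof.
elim: n => [|n IH] a u v; first by rewrite /= scaler0 addr0.
have [f fE] := linear_bundle IH; have [b bE] := linear_bundle Blin.
rewrite !YS fE bE (linearP b) !(linearP f) addrACA -scalerDr [LHS]scalerDr.
by rewrite !scalerA (mulrC a).
Qed.

Lemma sqrt_iter_sym n x y : rinner (Y n x) y = rinner x (Y n y).
Proof.
elim: n x y => [|n IH] x y.
  by rewrite /rinner linear0l linear0r.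
by rewrite !YS rinnerZl rinnerZr rinnerDl rinnerDr Bsym !IH.
Qed.

Lemma sqrt_iter_le n x : rnorm (Y n x) <= t n * rnorm x.
Proof.
elim: n x => [|n IH] x; first by rewrite /= rnorm0 mul0r.
rewrite YS tS rnormZ ger0_norm ?divr_ge0 // -[leRHS]mulrA.
rewrite ler_wpM2l ?divr_ge0 //.
apply: le_trans (ler_rnormD _ _) _; rewrite mulrDl mul1r lerD // expr2 -mulrA.
by apply: le_trans (IH _) _; rewrite ler_wpM2l ?sqrt_maj_ge0.
Qed.

(** Each iterate is a polynomial in [B]. Two uses of this make the iterates commute with one
    another. *)
Lemma sqrt_iter_comm (A : H -> H) n : linear A -> (forall x, A (B x) = B (A x)) ->
  forall x, A (Y n x) = Y n (A x).
Proof.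
move=> lA AB; have [f fE] := linear_bundle lA; rewrite fE in AB *.
elim: n => [|n IH] x; first by rewrite /= linear0.
by rewrite !YS linearZ linearD AB !IH.
Qed.

Lemma sqrt_iterC m n x : Y m (Y n x) = Y n (Y m x).
Proof.
apply: sqrt_iter_comm => [|z]; first exact: sqrt_iter_linear.
by rewrite -sqrt_iter_comm.
Qed.

(** Since iterates commute, half the difference of the squares of Y (n + 1) and Y n factors as half
    their sum applied to their difference; the scalars [t] factor in the same way. *)
Lemma sqrt_iterS_le n x : rnorm (Y n.+1 x - Y n x) <= (t n.+1 - t n) * rnorm x.
Proof.
elim: n x => [|n IH] x.
  rewrite /Y /t /= !addr0 expr0n /= !subr0 addr0 rnormZ.
  by rewrite mulr1 ger0_norm ?divr_ge0 // ler_wpM2l ?divr_ge0.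
set D := Y n.+1 x - Y n x.
have [f fE] := linear_bundle (sqrt_iter_linear n).
have [g gE] := linear_bundle (sqrt_iter_linear n.+1).
have -> : Y n.+2 x - Y n.+1 x = (1 / 2)%:C *: (Y n.+1 D + Y n D).
  have -> : Y n.+2 x - Y n.+1 x = (1 / 2)%:C *:
      (B x + Y n.+1 (Y n.+1 x) - (B x + Y n (Y n x))) by rewrite scalerBr.
  have -> : Y n.+1 D = Y n.+1 (Y n.+1 x) - Y n.+1 (Y n x) by rewrite gE -linearB -gE.
  have -> : Y n D = Y n (Y n.+1 x) - Y n (Y n x) by rewrite fE -linearB -fE.
  by rewrite opprD addrACA subrr add0r (sqrt_iterC n) addrA subrK.
rewrite rnormZ ger0_norm ?divr_ge0 //.
have h1 : rnorm (Y n.+1 D + Y n D) <= (t n.+1 + t n) * rnorm D.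
  by rewrite mulrDl (le_trans (ler_rnormD _ _)) // lerD // sqrt_iter_le.
have h2 : (t n.+1 + t n) * rnorm D <= (t n.+1 + t n) * ((t n.+1 - t n) * rnorm x).
  by rewrite ler_wpM2l ?IH // addr_ge0 ?sqrt_maj_ge0.
have -> : t n.+2 - t n.+1 = 1 / 2 * ((t n.+1 + t n) * (t n.+1 - t n)).
  by have := tS n; rewrite (tS n.+1); move: (t n.+1) (t n) => p q; lra.
by rewrite -[leRHS]mulrA ler_wpM2l ?divr_ge0 // (le_trans h1) // -[leRHS]mulrA.
Qed.

(** The increments telescope to t m - t n, at most 1 - t n. *)
Lemma sqrt_iter_cauchy n m x : (n <= m)%N ->
  rnorm (Y m x - Y n x) <= 2 * rnorm x / n.+1%:R.
Proof.
move=> nm; apply: (@le_trans _ _ ((t m - t n) * rnorm x)).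
  rewrite -(subnK nm); elim: (m - n)%N => [|k IH].
    by rewrite add0n !subrr rnorm0 mul0r.
  rewrite addSn; apply: le_trans (ler_rnorm_dist _ (Y (k + n) x) _) _.
  by rewrite -[t _.+1 - _](subrKA (t (k + n))) mulrDl lerD // sqrt_iterS_le.
rewrite mulrAC ler_wpM2r ?rnorm_ge0 //.
have /andP[_ h] := sqrt_maj_bound n; apply: le_trans h.
by have /andP[h _] := sqrt_maj_bound m; rewrite lerB // -subr_ge0.
Qed.

(** Each property holds for the iterates; its defect for [Z] is written through the errors Y n - Z
    and so is bounded by a multiple of 1 / (n + 1). *)
Lemma sqrt_iter_limit : exists Z : H -> H,
  [/\ linear Z, forall x y, rinner (Z x) y = rinner x (Z y),
      forall x, rnorm (Z x) <= rnorm x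
    & forall x, Z x = (1 / 2)%:C *: (B x + Z (Z x))].
Proof.
have [Z hZ] : exists Z : H -> H,
    forall x n, rnorm (Y n x - Z x) <= 2 * rnorm x / n.+1%:R.
  suff : forall x, exists z, forall n, rnorm (Y n x - z) <= 2 * rnorm x / n.+1%:R.
    by move/choice=> [Z hZ]; exists Z.
  by move=> x; apply: harmonic_cvg => n m; exact: sqrt_iter_cauchy.
have Yle n x : rnorm (Y n x) <= rnorm x.
  apply: le_trans (sqrt_iter_le _ _) _.
  have /andP[h _] := sqrt_maj_bound n; rewrite -[leRHS]mul1r.
  by rewrite ler_wpM2r ?rnorm_ge0 // -subr_ge0.
have Zle x : rnorm (Z x) <= rnorm x.
  rewrite -subr_le0; apply: (@ler_harmonic_le0 R (2 * rnorm x)) => n.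
  rewrite lerBlDr; apply: le_trans (lerD (hZ x n) (Yle n x)).
  by rewrite rnormB -[X in rnorm X <= _](subrK (Y n x)) ler_rnormD.
have Zlin : linear Z.
  move=> a x y; apply/eqP; rewrite -subr_eq0; apply/eqP/rnorm_le0.
  pose K := 2 * rnorm (a *: x + y) + complex.Re `|a| * (2 * rnorm x) + 2 * rnorm y.
  apply: (@ler_harmonic_le0 R K) => n.
  have -> : Z (a *: x + y) - (a *: Z x + Z y) =
      - (Y n (a *: x + y) - Z (a *: x + y)) +
      (a *: (Y n x - Z x) + (Y n y - Z y)).
    rewrite sqrt_iter_linear scalerBr opprB [X in _ = _ + X]addrACA.
    by rewrite -opprD [RHS]addrA subrK.
  rewrite /K [leRHS]mulrDl [X in _ <= X + _]mulrDl -addrA.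
  apply: le_trans (ler_rnormD _ _) _.
  rewrite rnormN lerD ?hZ //.
  apply: le_trans (ler_rnormD _ _) _; rewrite lerD ?hZ //.
  have -> : rnorm (a *: (Y n x - Z x)) = complex.Re `|a| * rnorm (Y n x - Z x).
    apply: (@complexI R); rewrite rmorphM -!normE normrZ; congr (_ * _).
    by symmetry; apply: RRe_real.
  by rewrite -mulrA ler_wpM2l ?hZ // -ler0c RRe_real.
have [z zE] := linear_bundle Zlin.
exists Z; split=> // [x y|x].
  apply/eqP; rewrite -subr_eq0 -normr_le0.
  apply/(@ler_harmonic_le0 R (4 * rnorm x * rnorm y)) => n.
  have -> : rinner (Z x) y - rinner x (Z y) =
      rinner x (Y n y - Z y) - rinner (Y n x - Z x) y.
    by rewrite rinnerBr rinnerBl sqrt_iter_sym; ring.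
  apply: le_trans (ler_normB _ _) _.
  have -> : 4 * rnorm x * rnorm y / n.+1%:R =
    rnorm x * (2 * rnorm y / n.+1%:R) + 2 * rnorm x / n.+1%:R * rnorm y by ring.
  rewrite lerD // (le_trans (normr_rinner_le _ _)) //.
    by rewrite ler_wpM2l ?rnorm_ge0.
  by rewrite ler_wpM2r ?rnorm_ge0.
apply/eqP; rewrite -subr_eq0; apply/eqP/rnorm_le0.
apply: (@ler_harmonic_le0 R (4 * rnorm x)) => n.
set h := (1 / 2)%:C.
(* Inserting Y (n + 1) x = (Bx + Y n (Y n x)) / 2 leaves three errors. Each is at most [q], the last
   two with weight 1/2, whence the constant 4. *)
have -> : Z x - h *: (B x + Z (Z x)) =
    - (Y n.+1 x - Z x) + h *: (Y n (Y n x - Z x) + (Y n (Z x) - Z (Z x))).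
  have [f fE] := linear_bundle (sqrt_iter_linear n).
  rewrite (YS n x) -/h fE (linearB f) subrKA opprB -[RHS]addrA; congr (_ + _).
  by rewrite -!scalerN -scalerDr; congr (_ *: _); rewrite !opprD -[RHS]addrA addKr.
apply: le_trans (ler_rnormD _ _) _; rewrite rnormN /h rnormZ ger0_norm ?divr_ge0 //.
set q := 2 * rnorm x / n.+1%:R.
have -> : 4 * rnorm x / n.+1%:R = q + 1 / 2 * (q + q) by rewrite /q; field.
rewrite lerD ?ler_wpM2l ?divr_ge0 //.
  apply: le_trans (hZ _ _) _.
  by rewrite ler_wpM2l ?mulr_ge0 ?rnorm_ge0 // lef_pV2 ?posrE ?ltr0n // ler_nat.
apply: le_trans (ler_rnormD _ _) _; rewrite lerD //.
  exact: le_trans (Yle _ _) (hZ _ _).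
by rewrite (le_trans (hZ _ _)) // ler_wpM2r ?invr_ge0 // ler_wpM2l.
Qed.

End Iteration.

(** Symmetry of the real parts extends to the complex form, so <Ax, x> equals its own conjugate and
    is real. *)
Lemma symmetric_positive_operator (A : H -> H) (C : R) : linear A ->
  (forall x, rnorm (A x) <= C * rnorm x) ->
  (forall x y, rinner (A x) y = rinner x (A y)) ->
  (forall x, 0 <= rinner (A x) x) -> positive_operator A.
Proof.
move=> lA bA sA pA; split.
  split=> //; exists C%:C => x.
  by rewrite !normE -rmorphM lecR.
move=> x; have sx : inner (A x) x = inner x (A x) by apply: rinner_inner.
rewrite lecE /= -/(rinner _ _) pA andbT.
move: sx; rewrite [RHS]innerC; case: (inner (A x) x) => a b [] /= h.
by apply/eqP; lra.
Qed.

(** For B = 1 - T* T / c^2 the iteration gives (1 - Z)^2 = 1 - B, so A = c (1 - Z) squares to T*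
    T. *)
Lemma sqrt_adjoint_exists (T : H -> H) : bounded_operator T ->
  exists A, positive_operator A /\ forall x, A (A x) = (adjoint T \o T) x.
Proof.
move=> bT; have [c0 _ /(_ bT)[c00 hc0]] := opnormE T.
(* Adding 1 keeps the divisor positive even when T = 0. *)
pose c := c0 + 1.
have cp : 0 < c by rewrite /c; lra.
have hc x : rnorm (T x) <= c * rnorm x.
  by apply: le_trans (hc0 x) _; rewrite ler_wpM2r ?rnorm_ge0 // /c; lra.
pose S x := adjoint T (T x).
have [T' TE] := linear_bundle bT.1.
have [T'' T''E] := linear_bundle (adjoint_linear bT).
pose B x := x - (c ^- 2)%:C *: S x.
have Ssym x y : rinner (S x) y = rinner x (S y).
  by rewrite /S -rinner_adjoint // rinnerC -rinner_adjoint // rinnerC.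
have [|||Z [Zl Zs Z1 ZE]] := @sqrt_iter_limit B.
- move=> a x y; rewrite /B /S T''E TE (linearP T') (linearP T'') scalerBr scalerDr opprD.
  by rewrite addrACA !scalerA (mulrC a).
- by move=> x y; rewrite /B rinnerBl rinnerBr rinnerZl rinnerZr Ssym.
(* Contractivity: |Bx|^2 = |x|^2 - 2 |Tx|^2 / c^2 + |Sx|^2 / c^4, and |Sx| <= c |Tx|. *)
- move=> x; rewrite -ler_sqr ?nnegrE ?rnorm_ge0 // -!rinnerii /B.
  rewrite !(rinnerBl, rinnerBr, rinnerZl, rinnerZr) (rinnerC x (S x)).
  have -> : rinner (S x) x = rnorm (T x) ^+ 2.
    by rewrite rinnerC -rinner_adjoint // rinnerii.
  have hS : rnorm (S x) <= c * rnorm (T x) by apply: rnorm_adjoint.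
  rewrite !rinnerii.
  have : rnorm (S x) ^+ 2 <= c ^+ 2 * rnorm (T x) ^+ 2.
    by rewrite -exprMn ler_sqr ?nnegrE ?mulr_ge0 ?rnorm_ge0 // ltW.
  move: (rnorm (S x) ^+ 2) (sqr_ge0 (rnorm (T x))).
  move: (rnorm (T x) ^+ 2) (rnorm x ^+ 2) => p q s p0 hs.
  have : c ^- 2 * s <= p by rewrite mulrC ler_pdivrMr ?exprn_gt0 // mulrC.
  have : 0 < c ^- 2 by rewrite invr_gt0 exprn_gt0.
  move: (c ^- 2) => d d0 ds; nra.
have [z zE] := linear_bundle Zl.
pose A x := c%:C *: (x - Z x).
exists A; split; last first.
  move=> x; rewrite /A zE linearZ -zE -scalerBr scalerA.
  have -> : x - Z x - Z (x - Z x) = x - B x.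
    rewrite zE linearB -zE.
    have : Z x + Z x = B x + Z (Z x).
      rewrite [X in X + X = _]ZE -scalerDl -rmorphD /=.
      by have -> : 1 / 2 + 1 / 2 = 1 :> R by [field]; rewrite scale1r.
    move=> e; have -> : B x = Z x + Z x - Z (Z x) by rewrite e addrK.
    by rewrite -[LHS]addrA -opprD (addrA (Z x)).
  rewrite /B subKr scalerA -!rmorphM /= -expr2 divff ?scale1r //.
  by rewrite expf_neq0 // gt_eqF.
apply: (@symmetric_positive_operator _ (2 * c)).
- move=> a x y; rewrite /A Zl opprD addrACA -scalerBr scalerDr !scalerA.
  by rewrite mulrC.
- move=> x; rewrite /A rnormZ gtr0_norm // -[2 * c * _]mulrA mulrCA ler_wpM2l ?(ltW cp) //.
  have := ler_rnormD x (- Z x); rewrite rnormN; have := Z1 x; lra.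
- by move=> x y; rewrite /A rinnerZl rinnerZr rinnerBl rinnerBr Zs.
(* Positivity of 1 - Z follows from Cauchy-Schwarz and |Zx| <= |x|. *)
- move=> x; rewrite /A rinnerZl; apply: mulr_ge0 (ltW cp) _; rewrite rinnerBl subr_ge0.
  apply: le_trans (rinner_le _ _) _.
  by rewrite rinnerii expr2 ler_wpM2r ?rnorm_ge0.
Qed.

End SquareRoot.

(** * Injective maps on finite-dimensional invariant subspaces *)

Section FiniteDimensional.
Variables (R : realType) (H : hilbertType R).
Variables (T : {linear H -> H}) (M : set H).
Hypothesis subM : is_subspace M.
Hypothesis TM : forall x, M x -> M (T x).
Hypothesis injT : forall x, M x -> T x = 0 -> x = 0.

Lemma iter_subspace i x : M x -> M (iter i T x).
Proof. by move=> Mx; elim: i => //= i; apply: TM. Qed.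

Lemma sum_subspace N (p : nat -> R[i]) (y : nat -> H) :
  (forall i, M (y i)) -> M (\sum_(i < N) p i *: y i).
Proof.
move=> My; elim/big_ind : _ => [|u v Mu Mv|i _]; first exact: subM.1.
  by have := subM.2 1 _ _ Mu Mv; rewrite scale1r.
by have := subM.2 (p i) _ _ (My i) subM.1; rewrite addr0.
Qed.

(* Dividing a vanishing combination of the T^i x by the lowest power of T that
   occurs, which injectivity allows, exhibits x in the range of T. *)
Lemma dependent_orbit_preimage N (p : nat -> R[i]) x : M x ->
  \sum_(i < N) p i *: iter i T x = 0 -> (exists2 i, (i < N)%N & p i != 0) ->
  exists2 w, M w & T w = x.
Proof.
move=> Mx; elim: N p => [|N IH] p; first by move=> _ [].
rewrite big_ord_recl /=; set S := \sum_(i < N) p i.+1 *: iter i T x.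
have -> : \sum_(i < N) p (bump 0 i) *: iter (bump 0 i) T x = T S.
  by rewrite linear_sum; apply: eq_bigr => i _; rewrite linearZ.
have MS : M S.
  by apply: (@sum_subspace N (fun i => p i.+1)) => i; exact: iter_subspace.
have [p0|p0] := eqVneq (p 0%N) 0.
  rewrite p0 scale0r add0r => /(injT MS) S0 [[|i] iN pi].
    by rewrite p0 eqxx in pi.
  by apply: (IH (fun i => p i.+1) S0); exists i.
move=> e _; exists (- (p 0%N)^-1 *: S).
  by have := subM.2 (- (p 0%N)^-1) _ _ MS subM.1; rewrite addr0.
move/eqP: e; rewrite addrC addr_eq0 => /eqP e.
by rewrite linearZ /= e scalerN scaleNr opprK scalerA mulVf // scale1r.
Qed.

(** The n + 1 vectors x, Tx, ..., T^n x lie in the span of n vectors, so they are dependent. The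
    spanning family need not be a basis. *)
Lemma finite_dimensional_surjective x : finite_dimensional M -> M x ->
  exists2 w, M w & T w = x.
Proof.
case=> s Ms Mx; set n := size s.
have [c hc] : exists c : nat -> nat -> R[i],
    forall i, iter i T x = \sum_(j < n) c i j *: s`_j.
  suff : forall i, exists c : nat -> R[i], iter i T x = \sum_(j < n) c j *: s`_j.
    by move/choice=> [c hc]; exists c.
  by move=> i; have := iter_subspace i Mx; rewrite Ms.
(* Row i holds coordinates of T^i x; having more rows than columns forces a nonzero vector in the
   left kernel. *)
pose C : 'M[R[i]]_(n.+1, n) := \matrix_(i, j) c i j.
have /rowV0Pn[v /sub_kermxP vC v0] : kermx C != 0.
  rewrite kermx_eq0 -row_leq_rank -ltnNge.
  exact: leq_ltn_trans (rank_leq_col C) _.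
apply: (@dependent_orbit_preimage n.+1 (fun i => v 0 (inord i)) x Mx).
  under eq_bigr => i _ do rewrite inord_val hc scaler_sumr.
  rewrite exchange_big big1 //= => j _.
  under eq_bigr => i _ do rewrite scalerA.
  rewrite -scaler_suml; have := congr1 (fun A : 'rV_n => A 0 j) vC.
  by rewrite !mxE; under eq_bigr => i _ do rewrite mxE; move=> ->; rewrite scale0r.
have /rV0Pn[i vi] := v0.
by exists i => //; rewrite inord_val.
Qed.

End FiniteDimensional.

(** * The norming set as an eigenspace *)

Section NormingSet.
Variables (R : realType) (H : hilbertType R) (T : H -> H) (c : R).
Hypothesis bT : bounded_operator T.
Hypothesis c0 : 0 <= c.
Hypothesis hc : forall x, rnorm (T x) <= c * rnorm x.
Hypothesis cE : opnorm T = c%:C.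

Lemma norming_setE x : norming_set T x <-> rnorm (T x) = c * rnorm x.
Proof.
rewrite /norming_set /= cE !normE -rmorphM.
by split=> [/(@complexI R)|->].
Qed.

(* The key estimate: ||T*Tx - c^2 x||^2 <= c^2 (c^2 ||x||^2 - ||Tx||^2). *)
Lemma norming_set_eigen x : norming_set T x <-> adjoint T (T x) = (c ^+ 2)%:C *: x.
Proof.
rewrite norming_setE; split=> [h|h].
  apply/eqP; rewrite -subr_eq0; apply/eqP/rnorm_le0.
  rewrite -(@ler_pXn2r _ 2) ?nnegrE ?rnorm_ge0 // expr0n -rinnerii.
  rewrite !(rinnerBl, rinnerBr, rinnerZl, rinnerZr) (rinnerC (adjoint _ _) x).
  rewrite -(rinner_adjoint x) // !rinnerii.
  have : rnorm (adjoint T (T x)) ^+ 2 <= (c * (c * rnorm x)) ^+ 2.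
    by rewrite ler_sqr ?nnegrE ?mulr_ge0 ?rnorm_ge0 // -h rnorm_adjoint.
  by rewrite h /=; lra.
apply/eqP; rewrite -(@eqrXn2 _ 2) ?mulr_ge0 ?rnorm_ge0 //; apply/eqP.
by rewrite exprMn -!rinnerii rinner_adjoint // h rinnerZr.
Qed.

(** Linearity is visible only in the eigenvector equation, not in the equality of norms. *)
Lemma norming_set_subspace : is_subspace (norming_set T).
Proof.
have [S SE] := linear_bundle (adjoint_linear bT).
have [f fE] := linear_bundle bT.1.
split=> [|a x y]; rewrite !norming_set_eigen.
  by rewrite SE fE !linear0.
move=> hx hy; rewrite SE fE (linearP f) (linearP S) -SE -fE hx hy.
by rewrite scalerDr !scalerA (mulrC a).
Qed.

Lemma norming_set_closed : closed (norming_set T).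
Proof.
have [f fE] := linear_bundle bT.1.
move=> x clx; apply/norming_setE/le_anti; rewrite hc /= -subr_le0.
(* Replacing [x] by a nearby [y] in the set costs c / (n + 1) in c |x| and again in |Tx|. *)
apply: (@ler_harmonic_le0 R (2 * c)) => n.
have n0 : 0 < (n.+1%:R^-1 : R)%:C by rewrite ltcR invr_gt0 ltr0n.
have [y [My]] := clx _ (nbhsx_ballx x _ n0).
rewrite -ball_normE /= normE ltcR => /ltW xy.
move/norming_setE: My => My.
have h1 : c * rnorm x <= c * (rnorm y + n.+1%:R^-1).
  rewrite ler_wpM2l // (le_trans _ (lerD (lexx _) xy)) //.
  by rewrite addrC -{1}[x](subrK y) ler_rnormD.
have h2 : rnorm (T y) <= rnorm (T x) + c * n.+1%:R^-1.
  rewrite -{1}[y](subrK x) {1}fE linearD -fE addrC.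
  apply: le_trans (ler_rnormD _ _) _; rewrite lerD // (le_trans (hc _)) //.
  by rewrite ler_wpM2l // rnormB.
by move: (n.+1%:R^-1) h1 h2 => e; rewrite My; lra.
Qed.

(** With P = |T|, so that P^2 = T* T, the eigenvector equation reads (P + c)(P - c) x = 0, and
    positivity of P allows P + c to be cancelled when c > 0. *)
Lemma norming_set_null :
  norming_set T = null_space (fun x => abs_operator T x - opnorm T *: x).
Proof.
have [[bP posP] PP] : positive_operator (abs_operator T) /\
    forall x, abs_operator T (abs_operator T x) = (adjoint T \o T) x.
  exact: (@xgetPex _ (fun=> 0) [set A | _ /\ _]) (sqrt_adjoint_exists bT).
move: (abs_operator T) bP posP PP => P bP posP PP.
have [p pE] := linear_bundle bP.1.
have pos x : 0 <= rinner (P x) x by have := posP x; rewrite lecE => /andP[].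
apply/seteqP; split=> x; rewrite norming_set_eigen /null_space /= cE; last first.
  move/eqP; rewrite subr_eq0 => /eqP e; have := PP x; rewrite /= => <-.
  by rewrite e pE linearZ /= -pE e scalerA -rmorphM.
move=> e; set y := P x - _.
have Py : P y = - (c%:C *: y).
  rewrite /y pE linearB linearZ /= -pE PP /= e scalerBr opprB scalerA -rmorphM.
  by rewrite -expr2 addrC.
have [cp|] := ltP 0 c.
  have := pos y; rewrite Py rinnerNl rinnerZl rinnerii oppr_ge0.
  rewrite pmulr_rle0 // => y2; apply: rnorm_le0.
  by rewrite -(@ler_pXn2r _ 2) ?nnegrE ?rnorm_ge0 // expr0n.
(* For c = 0, y = Px and Py = 0, so positivity at x + t y reads <Px, x> + t |y|^2 >= 0 for all real
   t, which forces y = 0. *)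
move=> c00; have cz : c = 0 by apply: le_anti; rewrite c0 c00.
have yE : y = P x by rewrite /y cz scale0r subr0.
apply: rnorm_le0; rewrite -(@ler_pXn2r _ 2) ?nnegrE ?rnorm_ge0 // expr0n /=.
have h (t : R) : 0 <= rinner (P x) x + t * rnorm y ^+ 2.
  have := pos (x + t%:C *: y); rewrite pE linearD linearZ /= -pE Py cz.
  by rewrite scale0r oppr0 scaler0 addr0 rinnerDr rinnerZr yE rinnerii.
rewrite leNgt; apply/negP => y0.
(* This [t] makes the expression equal to -1. *)
have := h (- (rinner (P x) x + 1) / rnorm y ^+ 2).
by rewrite mulfVK ?gt_eqF //; lra.
Qed.

Lemma norming_set_invariant : star_paranormal T -> invariant_subspace (norming_set T) T.
Proof.
move=> para _ [x Mx <-]; apply/norming_setE/le_anti; rewrite hc /=.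
have xE := Mx; move/norming_setE: xE => xE; move/norming_set_eigen: Mx => Mx.
have := para (T x); rewrite Mx !normE rnormZ -rmorphXn -rmorphM lecR.
rewrite ger0_norm ?exprn_ge0 // xE => h.
have hT : rnorm (T (T (T x))) <= c * rnorm (T (T x)) := hc _.
(* The inequality to prove, c^2 |x| <= |T^2 x|, is trivial when its left side vanishes; otherwise it
   is obtained after multiplying by that side. *)
have [x0|x0] := eqVneq (c * (c * rnorm x)) 0; first by rewrite x0 rnorm_ge0.
have cx : 0 < c * (c * rnorm x).
  by rewrite lt_neqAle eq_sym x0 !mulr_ge0 ?rnorm_ge0.
rewrite -(ler_pM2r cx).
apply: (le_trans (y := rnorm (T (T (T x))) * (c * rnorm x))).
  by apply: le_trans h; rewrite le_eqVlt; apply/orP; left; apply/eqP; ring.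
by rewrite [leRHS]mulrCA [leRHS]mulrA ler_wpM2r ?mulr_ge0 ?rnorm_ge0.
Qed.

Lemma norming_set_reduces : star_paranormal T ->
  finite_dimensional (norming_set T) -> reduces (norming_set T) T.
Proof.
move=> para fin; have inv := norming_set_invariant para; split=> // _ [y My <-] x Mx.
have [f fE] := linear_bundle bT.1.
(* Injectivity on the norming set comes from |Tz| = c |z| with c nonzero; for c = 0 the operator
   itself vanishes. *)
have [cz|cz] := eqVneq c 0.
  have -> : T y = 0 by apply: rnorm_le0; rewrite (le_trans (hc _)) // cz mul0r.
  by rewrite linear0r.
have [|z Mz z0|w Mw <-] :=
    @finite_dimensional_surjective R H f _ norming_set_subspace _ _ x fin Mx.
- by move=> z Mz; apply: inv; exists z => //; rewrite fE.
- move/norming_setE : Mz; rewrite fE z0 rnorm0 => /esym/eqP.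
  by rewrite mulf_eq0 (negbTE cz) rnorm_eq0 => /eqP.
move/norming_set_eigen : (Mw) => e.
by rewrite -fE innerC adjointP // e -innerC linearZl_LR /= (My w Mw) mulr0.
Qed.

End NormingSet.

Theorem theorem2p5 (R : realType) (H : hilbertType R) (T : H -> H)
    (Hinf : infinite_dimensional [set: H])
    (Tbounded : bounded_operator T)
    (Tattains : norm_attaining T)
    (Tpara : star_paranormal T) :
  let M := norming_set T in
  [/\ is_subspace M,
      closed M,
      M = null_space (fun x => abs_operator T x - opnorm T *: x),
      invariant_subspace M T
    & finite_dimensional M -> reduces M T].

Proof.
have [c cE /(_ Tbounded)[c0 hc]] := opnormE T.
split.
- exact: norming_set_subspace cE.
- exact: norming_set_closed cE.
- exact: norming_set_null cE.
- exact: norming_set_invariant cE _.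
- exact: norming_set_reduces cE _.
Qed.
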